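(* Let $X$ be a separable symmetric space on $[0,1]$ and let $f\in X$ satisfy $f=f^*$. Suppose the system $\{V^\alpha f\}_{\alpha\in\mathbb{A}}$ is an absolutely representing system in $X$ with constant $C$, i.e. for every $x\in X$ there exist real coefficients $\{\xi_\alpha\}_{\alpha\in\mathbb{A}}$ with $x=\sum_{k=0}^\infty\sum_{|\alpha|=k}\xi_\alpha V^\alpha f$ in $X$ and $\sum_{k=0}^\infty\bigl\|\sum_{|\alpha|=k}\xi_\alpha V^\alpha f\bigr\|_X\le C\|x\|_X$. Then $$\|\sigma_tf\|_X\le 2C\Bigl|\int_0^1f(s)\,ds\Bigr|\,\phi_X(t),\qquad 0<t\le1.$$
   Context: A symmetric space $X$ on $[0,1]$ is a Banach space of (equivalence classes of) real-valued Lebesgue measurable functions on $[0,1]$ such that: (a) if $y\in X$ and $x$ is measurable with $|x|\le|y|$ a.e., then $x\in X$ and $\|x\|_X\le\|y\|_X$; (b) if $x,y$ are equimeasurable and $y\in X$, then $x\in X$ and $\|x\|_X=\|y\|_X$; normalized so that $\|\chi_{[0,1]}\|_X=1$. $x^*$ denotes the decreasing right-continuous rearrangement of $|x|$, $x^*(t)=\inf\{s\ge0: m\{|x|>s\}\le t\}$; so $f=f^*$ means $f$ is nonnegative, nonincreasing and right-continuous. The fundamental function is $\phi_X(t)=\|\chi_{[0,t]}\|_X$. The dilation operator is $\sigma_\tau x(t)=x(t/\tau)\chi_{(0,\min(1,\tau))}(t)$. For $f\in L_1[0,1]$: $V_0f(t)=f(2t)$ on $[0,\frac12]$, $0$ on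 $(\frac12,1]$; $V_1f(t)=0$ on $[0,\frac12)$, $f(2t-1)$ on $[\frac12,1]$. $\mathbb{A}=\bigcup_{k\ge0}\{0,1\}^k$; for $\alpha=(\alpha_1,\dots,\alpha_k)$, $|\alpha|=k$, $V^\alpha f=V_{\alpha_1}\cdots V_{\alpha_k}f$ (identity for $k=0$), i.e. $V^\alpha f(t)=f(2^kt-i)$ on $[i2^{-k},(i+1)2^{-k}]$, $0$ elsewhere, $i=\sum\alpha_\nu2^{k-\nu}$. *)

(* Defs.v *)
From HB Require Import structures.
From mathcomp Require Import all_boot all_order all_algebra.
From mathcomp Require Import all_classical all_reals all_analysis.
Set Implicit Arguments. Unset Strict Implicit. Unset Printing Implicit Defensive.
Import Order.TTheory GRing.Theory Num.Theory.
Local Open Scope classical_set_scope.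
Local Open Scope ring_scope.

Section SymSpace.
Variable R : realType.

Notation mu := (@lebesgue_measure R).

Definition ae01 (P : R -> Prop) : Prop :=
  {ae mu, forall t, `[0%R : R, 1%R]%classic t -> P t}.

Definition meas01 (x : R -> R) : Prop := measurable_fun `[0%R : R, 1%R]%classic x.

Definition equimeasurable (x y : R -> R) : Prop :=
  forall s : R, mu (`[0%R : R, 1%R]%classic `&` [set t | s < x t]) =
                mu (`[0%R : R, 1%R]%classic `&` [set t | s < y t]).

Definition rearr (x : R -> R) (t : R) : \bar R :=
  ereal_inf [set s%:E | s in
    [set s : R | 0 <= s /\ (mu (`[0%R : R, 1%R]%classic `&` [set u | (s < `|x u|)%R]) <= t%:E)%E]].

Definition indic01 (a : R) : R -> R := fun t => if (0 <= t) && (t <= a) then 1 else 0.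

(* A symmetric space on [0,1], encoded by its (extended-valued) norm rho:
   X = {x measurable on [0,1] | rho x < +oo}, ||x||_X = rho x. *)
Definition inX (rho : (R -> R) -> \bar R) (x : R -> R) : Prop :=
  meas01 x /\ (rho x < +oo)%E.

Record symmetric_space (rho : (R -> R) -> \bar R) : Prop := {
  ss_ge0 : forall x, meas01 x -> (0 <= rho x)%E;
  ss_eq0 : forall x, meas01 x -> (rho x = 0%E <-> ae01 (fun t => x t = 0));
  ss_hom : forall (a : R) x, meas01 x ->
      rho (fun t => a * x t) = (`|a|%:E * rho x)%E;
  ss_tri : forall x y, meas01 x -> meas01 y ->
      (rho (fun t => (x t + y t)%R) <= rho x + rho y)%E;
  ss_complete : forall u : nat -> R -> R, (forall n, inX rho (u n)) ->
      (forall eps : R, 0 < eps -> exists N, forall m n, (N <= m)%N -> (N <= n)%N ->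
          (rho (fun t => (u m t - u n t)%R) < eps%:E)%E) ->
      exists x, inX rho x /\ (fun n => rho (fun t => x t - u n t)) @ \oo --> 0%E;
  ss_ideal : forall x y, meas01 x -> meas01 y ->
      ae01 (fun t => `|x t| <= `|y t|) -> (rho x <= rho y)%E;
  ss_sym : forall x y, meas01 x -> meas01 y -> equimeasurable x y -> rho x = rho y;
  ss_norm : rho (indic01 1) = 1%E }.

Definition separable_space (rho : (R -> R) -> \bar R) : Prop :=
  exists d : nat -> R -> R, (forall n, inX rho (d n)) /\
    forall x, inX rho x -> forall eps : R, 0 < eps ->
      exists n, (rho (fun t => (x t - d n t)%R) < eps%:E)%E.

Definition fund (rho : (R -> R) -> \bar R) (t : R) : \bar R := rho (indic01 t).

Definition dil (tau : R) (x : R -> R) : R -> R :=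
  fun t => if (0 < t) && (t < Num.min 1 tau) then x (t / tau) else 0.

Definition V0 (f : R -> R) : R -> R :=
  fun t => if t <= 2^-1 then f (2 * t) else 0.
Definition V1 (f : R -> R) : R -> R :=
  fun t => if t < 2^-1 then 0 else f (2 * t - 1).
Definition Vb (b : bool) := if b then V1 else V0.

Definition Valpha (alpha : seq bool) (f : R -> R) : R -> R :=
  foldr (fun b g => Vb b g) f alpha.

Definition block (xi : seq bool -> R) (f : R -> R) (k : nat) : R -> R :=
  fun t => \sum_(a : k.-tuple bool) xi (tval a) * Valpha (tval a) f t.

Definition partial_sum (xi : seq bool -> R) (f : R -> R) (n : nat) : R -> R :=
  fun t => \sum_(k < n) block xi f k t.

Definition abs_representing (rho : (R -> R) -> \bar R) (f : R -> R) (C : R) : Prop :=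
  forall x, inX rho x -> exists xi : seq bool -> R,
    (fun n => rho (fun t => x t - partial_sum xi f n t)) @ \oo --> 0%E /\
    (\sum_(0 <= k <oo) rho (block xi f k) <= (C%:E * rho x))%E.

End SymSpace.

(* Main.v *)
(* Let rho_n(g) be the norm of the copy V_1^n g of g placed on the last dyadic
   interval of rank n.  Each rho_n is again a symmetric seminorm, and averaging
   the two halves of a function, T h (t) = (h(t/2) + h((1+t)/2))/2, is a
   contraction for every such seminorm: T h (+) T h is the mean of h and of the
   equimeasurable function obtained by swapping the halves of h.  Moreover T
   preserves the integral and T^N h tends to the constant int h in L_1, whence
   |int h| rho(V_1 1) / 2 <= rho(h), so integration is continuous for rho.
   Expand the indicator V_1^n 1 of the last interval in the system and integrate
   over that interval.  A block of rank k >= n becomes, after k - n applications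
   of T, a multiple of f; a block of rank k < n is there a multiple of a final
   piece of f, which is at most f after rescaling to [0,1].  Either way
   |b_k| rho_n(f) <= (int f) rho(block_k) for its normalized integral b_k.  As
   the b_k sum to 1, rho_n(f) <= C (int f) rho_n(1).  Finally a general t is squeezed between
   2^-(n+1) and 2^-n, which costs the factor 2. *)
Require Import Defs.
From HB Require Import structures.
From mathcomp Require Import all_boot all_order all_algebra.
From mathcomp Require Import all_classical all_reals all_analysis.
From mathcomp Require Import ring lra measurable_realfun.
Set Implicit Arguments. Unset Strict Implicit. Unset Printing Implicit Defensive.
Import Order.TTheory GRing.Theory Num.Theory.
Import numFieldNormedType.Exports.
Local Open Scope classical_set_scope.
Local Open Scope ring_scope.

Local Notation mu := (@lebesgue_measure _).
Local Notation D01 := (`[0%R, 1%R]%classic).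

(** * Affine images of Lebesgue measure *)

Definition aff {R : realType} (c d : R) : R -> R := fun t => c * t + d.

Section affine.
Context {R : realType}.
Implicit Types (c d : R) (A : set R) (h : R -> R).

Lemma measurable_aff c d : measurable_fun setT (aff c d).
Proof. by apply: measurable_funD => //; exact: measurable_funM. Qed.

Lemma measurable_aff_preimage c d A : measurable A -> measurable (aff c d @^-1` A).
Proof. by move=> mA; rewrite -[X in measurable X]setTI; exact: measurable_aff. Qed.

Let push c d : {measure set (measurableTypeR R) -> \bar R} :=
  measure_function_pushforward__canonical__measure_function_Measure
    (@lebesgue_measure R)
    (@measurable_aff c d : measurable_fun (setT : set (measurableTypeR R))
       (aff c d : _ -> measurableTypeR R)).

(** Uniqueness of Lebesgue measure reduces this to intervals ]a, b], whose preimage has length (b -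
    a) / c; the scaling by c restores b - a. *)
Let mscale_push c d (c0 : 0 < c) A : measurable A ->
  mscale (NngNum (ltW c0)) (push c d) A = lebesgue_measure A.
Proof.
move=> mA; apply/esym/lebesgue_measure_unique => //=.
move=> _ [[a b] _ <-].
rewrite /mscale/= /pushforward.
have -> : aff c d @^-1` [set` `]a, b] ] = [set` `](a - d) / c, (b - d) / c] ].
  apply/seteqP; split => t /=; rewrite !in_itv/= /aff ler_pdivlMr// ltr_pdivrMr//;
    by move=> /andP[? ?]; apply/andP; split; lra.
rewrite !lebesgue_measure_itv/= !lte_fin ltr_pM2r ?invr_gt0// ltrD2r.
case: ifPn => _; last by rewrite mule0.
rewrite -!EFinB -EFinM; congr EFin; field; exact: lt0r_neq0.
Qed.

Lemma aff_measure c d A : 0 < c -> measurable A ->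
  lebesgue_measure (aff c d @^-1` A) = (c^-1%:E * lebesgue_measure A)%E.
Proof.
move=> c0 mA; rewrite -[in RHS](mscale_push d c0)// /mscale/=.
by rewrite muleA -EFinM mulVf ?lt0r_neq0// mul1e.
Qed.

Lemma negligible_aff c d A : 0 < c -> lebesgue_measure.-negligible A ->
  lebesgue_measure.-negligible (aff c d @^-1` A).
Proof.
move=> c0 [N [mN N0 AN]]; exists (aff c d @^-1` N); split.
- exact: measurable_aff_preimage.
- by rewrite aff_measure// N0 mule0.
- by move=> t /AN.
Qed.

(** Lebesgue measure is c times its own image under the affine map, and integrating against an image
    measure means integrating the composition. *)
Lemma ge0_integral_aff c d A (h : R -> \bar R) : 0 < c -> measurable A ->
  measurable_fun A h -> (forall t, A t -> 0 <= h t)%E ->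
  (\int[lebesgue_measure]_(t in aff c d @^-1` A) h (aff c d t) =
   c^-1%:E * \int[lebesgue_measure]_(t in A) h t)%E.
Proof.
move=> c0 mA mh h0.
have -> : (\int[lebesgue_measure]_(t in A) h t =
   \int[mscale (NngNum (ltW c0)) (push c d)]_(t in A) h t)%E.
  by apply: eq_measure_integral => B mB _; apply/esym; exact: mscale_push.
rewrite ge0_integral_mscale//=.
have -> : (\int[push c d]_(t in A) h t =
    \int[mu]_(t in aff c d @^-1` A) h (aff c d t))%E.
  by apply: (@ge0_integral_pushforward _ _ (measurableTypeR R) (measurableTypeR R)
    R (aff c d) (measurable_aff c d) (@lebesgue_measure R) A h mA mh) => y /set_mem/h0.
by rewrite muleA -EFinM mulVf ?lt0r_neq0// mul1e.
Qed.

End affine.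

(** * Cutting a function on [0,1] into halves, gluing and averaging them *)

Definition joinh {R : realType} (a b : R -> R) : R -> R :=
  fun t => if t < 2^-1 then a (aff 2 0 t) else b (aff 2 (- 1) t).
Definition lhalf {R : realType} (h : R -> R) : R -> R := fun t => h (aff 2^-1 0 t).
Definition rhalf {R : realType} (h : R -> R) : R -> R := fun t => h (aff 2^-1 2^-1 t).
(** The transfer operator of the doubling map t -> 2t mod 1. *)
Definition transfer {R : realType} (h : R -> R) : R -> R :=
  fun t => 2^-1 * lhalf h t + 2^-1 * rhalf h t.

Section halves.
Context {R : realType}.
Implicit Types (a b h : R -> R) (A : set R) (P : R -> Prop).

Lemma V1E h : V1 h = joinh (fun=> 0) h.
Proof. by []. Qed.

Lemma joinhK h : joinh (lhalf h) (rhalf h) = h.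
Proof.
apply/funext => t; rewrite /joinh /lhalf /rhalf /aff.
by case: ifP => _; congr h; lra.
Qed.

Lemma measurable_comp_aff c d (E : set R) h : (forall t, E t -> D01 (aff c d t)) ->
  meas01 h -> measurable_fun E (fun t => h (aff c d t)).
Proof.
move=> cd mh; apply: (@measurable_comp _ _ _ (measurableTypeR R)
  (measurableTypeR R) (measurableTypeR R) D01 h E (aff c d)) => //.
- by move=> _ [t /cd ? <-].
- by apply: measurable_funTS; exact: measurable_aff.
Qed.

Lemma meas01_lhalf h : meas01 h -> meas01 (lhalf h).
Proof. by apply: measurable_comp_aff => t; rewrite /= !in_itv/= /aff; lra. Qed.

Lemma meas01_rhalf h : meas01 h -> meas01 (rhalf h).
Proof. by apply: measurable_comp_aff => t; rewrite /= !in_itv/= /aff; lra. Qed.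

Lemma meas01_joinh a b : meas01 a -> meas01 b -> meas01 (joinh a b).
Proof.
move=> ma mb; apply: measurable_fun_if => //.
- by apply: measurable_fun_ltr.
- by apply: measurable_comp_aff => // t [] /=; rewrite !in_itv/= /aff; lra.
- by apply: measurable_comp_aff => // t [] /=; rewrite !in_itv/= /aff; lra.
Qed.

Lemma meas01_transfer h : meas01 h -> meas01 (transfer h).
Proof.
move=> mh; apply: measurable_funD; apply: measurable_funM => //.
- exact: meas01_lhalf.
- exact: meas01_rhalf.
Qed.

Lemma measure_co01 A : measurable A -> mu (`[0%R, 1%R[%classic `&` A) = mu (D01 `&` A).
Proof.
move=> mA; apply/eqP; rewrite eq_le; apply/andP; split.
  apply: le_measure; rewrite ?inE; try exact: measurableI.
  by apply: setSI => t /=; rewrite !in_itv/=; lra.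
have mcoA : measurable (`[0%R, 1%R[%classic `&` A) by exact: measurableI.
have <- : mu ((`[0%R, 1%R[%classic `&` A) `|` [set 1]) = mu (`[0%R, 1%R[%classic `&` A).
  by apply: measureU0 => //; exact: lebesgue_measure_set1.
apply: le_measure; rewrite ?inE; [exact: measurableI|exact: measurableU|].
move=> t /=; rewrite !in_itv/= => -[/andP[t0 t1] At].
by case: (eqVneq t 1) => ?; [right|left; split => //; lra].
Qed.

(** The two halves are disjoint copies shrunk by 1/2, so the distribution of a join is the mean of
    the two distributions. All equimeasurability of joins rests on this. *)
Lemma dist_joinh a b A : meas01 a -> meas01 b -> measurable A ->
  mu (D01 `&` joinh a b @^-1` A) =
  (2^-1%:E * (mu (D01 `&` a @^-1` A) + mu (D01 `&` b @^-1` A)))%E.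
Proof.
move=> ma mb mA.
have mDa : measurable (D01 `&` a @^-1` A) by exact: ma.
have mDb : measurable (D01 `&` b @^-1` A) by exact: mb.
have -> : D01 `&` joinh a b @^-1` A =
   (aff 2 0 @^-1` (`[0%R, 1%R[%classic `&` (D01 `&` a @^-1` A))) `|`
   (aff 2 (-1) @^-1` (D01 `&` b @^-1` A)).
  apply/seteqP; split => t /=; rewrite /joinh/= !in_itv/=.
    case: ltP => t2 [t01 At]; [left|right]; (do !split => //); rewrite /aff; lra.
  case=> [[t1 [t2]]|[t1]] At.
    rewrite ifT; last by rewrite /aff in t1 *; lra.
    by split => //; move: t1; rewrite /aff; lra.
  rewrite ifF; last by apply/negbTE; rewrite /aff in t1 *; lra.
  by split => //; move: t1; rewrite /aff; lra.
rewrite measureU//=.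
- rewrite !aff_measure// ?measure_co01//.
    by rewrite setIA setIid ge0_muleDr.
  exact: measurableI.
- by apply: measurable_aff_preimage; exact: measurableI.
- exact: measurable_aff_preimage.
- by apply/seteqP; split => t //=; rewrite !in_itv/= /aff => -[[? _] [? _]]; lra.
Qed.

Lemma ae01_oo P : (forall t, 0 < t -> t < 1 -> P t) -> ae01 P.
Proof.
move=> h; exists ([set 0] `|` [set 1]); split.
- exact: measurableU.
- by apply: null_set_setU => //; exact: lebesgue_measure_set1.
- move=> t /= /existsNP[/= + nP]; rewrite in_itv/= => t01.
  apply: contrapT => /not_orP [/eqP t0 /eqP t1]; apply: nP; apply: h; lra.
Qed.

Lemma ae01_neq c P : (forall t, D01 t -> t != c -> P t) -> ae01 P.
Proof.
move=> h; exists [set c]; split => //; first exact: lebesgue_measure_set1.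
move=> t /= /existsNP[/= t01 nP]; apply: contrapT => /eqP tc.
by apply: nP; exact: h.
Qed.

(** Null sets pull back to null sets. [P] is controlled only on [0,1], which the affine map may
    leave, hence the guard before [P]. *)
Lemma ae01_aff c d P (Q : R -> Prop) : 0 < c -> ae01 P ->
  (forall t, D01 t -> (D01 (aff c d t) -> P (aff c d t)) -> Q t) -> ae01 Q.
Proof.
move=> c0 /(negligible_aff d c0) nP PQ.
by apply: negligibleS nP => t /= nQ Pt; apply: nQ => t01; exact: PQ.
Qed.

Lemma ae01_mono2 P P' (Q : R -> Prop) : ae01 P -> ae01 P' ->
  (forall t, D01 t -> P t -> P' t -> Q t) -> ae01 Q.
Proof.
move=> nP nP' PQ; apply: (negligibleS _ (negligibleU nP nP')) => t /= nQ.
apply: contrapT => /not_orP[/contrapT Pt /contrapT Pt'].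
by apply: nQ => t01; apply: PQ; [|exact: Pt|exact: Pt'].
Qed.

Lemma ae01_mono P (Q : R -> Prop) : ae01 P ->
  (forall t, D01 t -> P t -> Q t) -> ae01 Q.
Proof. by move=> nP PQ; apply: (ae01_mono2 nP nP) => t t01 + _; exact: PQ. Qed.

End halves.

(** * Integrals under affine changes of variable *)

Local Notation integrable01 h := (lebesgue_measure.-integrable `[0%R, 1%R]%classic (EFin \o h)).

Section integrals.
Context {R : realType}.
Implicit Types (a b h : R -> R) (A : set R) (P : R -> Prop).
Local Notation mu := (@lebesgue_measure R).

Lemma integral_aff c d (E : set R) h : 0 < c -> measurable E ->
  mu.-integrable E (EFin \o h) ->
  (\int[mu]_(t in aff c d @^-1` E) (h (aff c d t))%:E =
   c^-1%:E * \int[mu]_(t in E) (h t)%:E)%E.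
Proof.
move=> c0 mE ih.
have mh := measurable_int _ ih.
rewrite integralE [in RHS]integralE muleBr//; last first.
  apply: fin_num_adde_defr; exact: integrable_pos_fin_num.
congr (_ - _)%E.
- rewrite -(ge0_integral_aff d c0 mE)//; last exact: measurable_funepos mh.
  by apply: eq_integral => t _; rewrite !unlock.
- rewrite -(ge0_integral_aff d c0 mE)//; last exact: measurable_funeneg mh.
  by apply: eq_integral => t _; rewrite !unlock.
Qed.

Lemma integrable_aff c d (E : set R) h : 0 < c -> measurable E ->
  mu.-integrable E (EFin \o h) ->
  mu.-integrable (aff c d @^-1` E) (EFin \o (fun t => h (aff c d t))).
Proof.
move=> c0 mE ih; have mh := measurable_int _ ih.
apply/integrableP; split.
  apply: (@measurable_comp _ _ _ (measurableTypeR R)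
    (measurableTypeR R) _ E (EFin \o h) _ (aff c d)) => //.
  - by move=> _ [t ? <-].
  - by apply: measurable_funTS; exact: measurable_aff.
rewrite (ge0_integral_aff d c0 mE (h := fun t => `|(EFin \o h) t|%E))//.
  by apply: lte_mul_pinfty => //; [rewrite lee_fin invr_ge0 ltW|case/integrableP: ih].
exact: measurableT_comp.
Qed.

Lemma Rintegral_aff c d (E : set R) h : 0 < c -> measurable E ->
  mu.-integrable E (EFin \o h) ->
  \int[mu]_(t in aff c d @^-1` E) h (aff c d t) = c^-1 * \int[mu]_(t in E) h t.
Proof.
move=> c0 mE ih; rewrite /Rintegral integral_aff// fineM//.
exact: integrable_fin_num.
Qed.

Let pre_lhalf : aff (2^-1 : R) 0 @^-1` `[0, 2^-1]%classic = `[0, 1]%classic.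
Proof. by apply/seteqP; split => t /=; rewrite !in_itv/= /aff; lra. Qed.

Let pre_rhalf : aff (2^-1 : R) 2^-1 @^-1` `[2^-1, 1]%classic = `[0, 1]%classic.
Proof. by apply/seteqP; split => t /=; rewrite !in_itv/= /aff; lra. Qed.

Let sub_lhalf : `[(0:R), 2^-1]%classic `<=` `[0, 1]%classic.
Proof. by move=> t /=; rewrite !in_itv/=; lra. Qed.

Let sub_rhalf : `[(2^-1:R), 1]%classic `<=` `[0, 1]%classic.
Proof. by move=> t /=; rewrite !in_itv/=; lra. Qed.

Lemma integrable_lhalf h : integrable01 h -> integrable01 (lhalf h).
Proof.
by move=> ih; rewrite -pre_lhalf; apply: integrable_aff => //; exact: integrableS ih.
Qed.

Lemma integrable_rhalf h : integrable01 h -> integrable01 (rhalf h).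
Proof.
by move=> ih; rewrite -pre_rhalf; apply: integrable_aff => //; exact: integrableS ih.
Qed.

Lemma integrable01Z (c : R) h : integrable01 h -> integrable01 (fun t => c * h t).
Proof. by move=> ih; apply: (@integrableZl _ _ _ mu _ _ c (EFin \o h)). Qed.

Lemma integrable01D a b : integrable01 a -> integrable01 b ->
  integrable01 (fun t => a t + b t).
Proof. by move=> ia ib; apply: (@integrableD _ _ _ mu _ _ (EFin \o a) (EFin \o b)). Qed.

Lemma integrable_transfer h : integrable01 h -> integrable01 (transfer h).
Proof.
move=> ih; apply: integrable01D; apply: integrable01Z.
- exact: integrable_lhalf.
- exact: integrable_rhalf.
Qed.

(** Stretching a half to [0,1] doubles its integral, which the weight 1/2 undoes. *)
Lemma Rintegral_transfer h : integrable01 h ->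
  \int[mu]_(t in `[0%R, 1%R]) transfer h t = \int[mu]_(t in `[0%R, 1%R]) h t.
Proof.
move=> ih.
rewrite RintegralD//; last 2 first.
- by apply: integrable01Z; exact: integrable_lhalf.
- by apply: integrable01Z; exact: integrable_rhalf.
rewrite !RintegralZl//; last 2 first.
- exact: integrable_rhalf.
- exact: integrable_lhalf.
have <- : \int[mu]_(t in `[0%R, 2^-1]) h t + \int[mu]_(t in `[2^-1%R, 1]) h t =
    \int[mu]_(t in `[0%R, 1%R]) h t.
  have E : `[(0:R), 1]%classic = `[0, 2^-1[%classic `|` `[2^-1, 1]%classic.
    apply/seteqP; split => t /=; rewrite !in_itv/=; last by lra.
    by case: (ltP t 2^-1) => ? ?; [left|right]; lra.
  rewrite [in RHS]E Rintegral_setU//; last 2 first.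
  - by rewrite -E.
  - by apply/disj_setPS => t /=; rewrite !in_itv/=; lra.
  rewrite Rintegral_itv_bndo_bndc//.
  by apply: integrableS ih => // t /=; rewrite !in_itv/=; lra.
rewrite -{1}pre_lhalf -pre_rhalf !Rintegral_aff//; last 2 first.
- exact: integrableS ih.
- exact: integrableS ih.
by rewrite !mulrA !mulfV// !mul1r.
Qed.

End integrals.

(** * Iterated averages converge to the mean *)

Section ergodic.
Context {R : realType}.
Implicit Types (a b h g : R -> R).
Local Notation mu := (@lebesgue_measure R).

Lemma integrable01_cst (r : R) : integrable01 (fun=> r).
Proof.
have := @continuous_compact_integrable R (fun=> r) _ (@segment_compact R 0 1).
by apply; apply: continuous_subspaceT => x; exact: cvg_cst.
Qed.

Lemma measure01 : mu `[0%R, 1%R]%classic = 1%E.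
Proof. by rewrite lebesgue_measure_itv/= lte_fin ltr01 oppr0 adde0. Qed.

Lemma Rintegral01_cst (r : R) : \int[mu]_(t in `[0%R, 1%R]) r = r.
Proof. by rewrite Rintegral_cst//= measure01 mulr1. Qed.

Lemma integrable_iter_transfer N h :
  integrable01 h -> integrable01 (iter N transfer h).
Proof. by move=> ih; elim: N => //= N IH; exact: integrable_transfer. Qed.

Lemma Rintegral_iter_transfer N h : integrable01 h ->
  \int[mu]_(t in `[0%R, 1%R]) iter N transfer h t = \int[mu]_(t in `[0%R, 1%R]) h t.
Proof.
move=> ih; elim: N => //= N <-.
by rewrite Rintegral_transfer//; exact: integrable_iter_transfer.
Qed.

Lemma integrable01_norm h : integrable01 h -> integrable01 (fun t => `|h t|).
Proof. by move=> ih; apply: (@integrable_norm _ _ _ mu _ h). Qed.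

(** Pointwise |T h| <= T |h|, and T preserves the integral of |h|. *)
Lemma Rintegral_norm_transfer h : integrable01 h ->
  \int[mu]_(t in `[0%R, 1%R]) `|transfer h t| <= \int[mu]_(t in `[0%R, 1%R]) `|h t|.
Proof.
move=> ih; rewrite -(Rintegral_transfer (integrable01_norm ih)).
apply: le_Rintegral => //.
- exact/integrable01_norm/integrable_transfer.
- exact/integrable_transfer/integrable01_norm.
- move=> t _; apply: le_trans (ler_normD _ _) _.
  by rewrite !normrM ger0_norm.
Qed.

Lemma Rintegral_norm_iter_transfer N h : integrable01 h ->
  \int[mu]_(t in `[0%R, 1%R]) `|iter N transfer h t| <=
  \int[mu]_(t in `[0%R, 1%R]) `|h t|.
Proof.
move=> ih; elim: N => //= N; apply: le_trans.
exact/Rintegral_norm_transfer/integrable_iter_transfer.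
Qed.

Lemma iter_transferB N a b t :
  iter N transfer (fun t => a t - b t) t = iter N transfer a t - iter N transfer b t.
Proof.
elim: N t => //= N IH t; rewrite /transfer /lhalf /rhalf !IH; ring.
Qed.

(** T evaluates g at x/2, y/2 and at (1+x)/2, (1+y)/2, pairs only half as far apart as x and y. *)
Lemma transfer_modulus (d e : R) g :
  (forall x y, 0 <= x <= 1 -> 0 <= y <= 1 -> `|x - y| <= d -> `|g x - g y| <= e) ->
  forall x y, 0 <= x <= 1 -> 0 <= y <= 1 -> `|x - y| <= 2 * d ->
  `|transfer g x - transfer g y| <= e.
Proof.
move=> gd x y x01 y01 xyd; rewrite /transfer/= /lhalf/= /rhalf/= /aff/=.
have hd c : `|2^-1 * x + c - (2^-1 * y + c)| <= d.
  have -> : 2^-1 * x + c - (2^-1 * y + c) = 2^-1 * (x - y) by ring.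
  by rewrite normrM ger0_norm//; lra.
have h1 : `|g (2^-1 * x + 0) - g (2^-1 * y + 0)| <= e by apply: gd; rewrite ?hd//; lra.
have h2 : `|g (2^-1 * x + 2^-1) - g (2^-1 * y + 2^-1)| <= e by apply: gd; rewrite ?hd//; lra.
move: h1 h2; rewrite !ler_norml; lra.
Qed.

Lemma iter_transfer_modulus N (d e : R) g :
  (forall x y, 0 <= x <= 1 -> 0 <= y <= 1 -> `|x - y| <= d -> `|g x - g y| <= e) ->
  forall x y, 0 <= x <= 1 -> 0 <= y <= 1 -> `|x - y| <= 2 ^+ N * d ->
  `|iter N transfer g x - iter N transfer g y| <= e.
Proof.
move=> gd; elim: N => [|N IH] x y; first by rewrite expr0 mul1r; exact: gd.
by rewrite exprS -mulrA; exact: transfer_modulus.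
Qed.

Lemma unif_continuous01 g (e : R) : continuous g -> 0 < e ->
  exists2 d, 0 < d &
  forall x y, 0 <= x <= 1 -> 0 <= y <= 1 -> `|x - y| <= d -> `|g x - g y| <= e.
Proof.
move=> cg e0.
have /compact_near_coveringP near_cov := @segment_compact R 0 1.
(* Compactness in near-covering form: what holds near each point of the segment for all small d > 0
   holds on the whole segment for all small d > 0. *)
have H : \forall d \near 0^'+, `[0, 1]%classic `<=`
    (fun x => forall y, `|x - y| <= d -> `|g x - g y| <= e).
  apply: (near_cov R (0^'+) (fun d x => forall y, `|x - y| <= d -> `|g x - g y| <= e)) => x _.
  have /cvgrPdist_le/(_ (e / 2)) := cg x.
  rewrite divr_gt0// => /(_ isT)/nbhs_ballP[r /= r0 rg].
  (* With both radii r/2, the points z and y lie within r of x, and two errors e/2 add up to e. *)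
  exists (ball x (r / 2), [set d | d < r / 2]).
    split => /=; first by apply: nbhsx_ballx; rewrite divr_gt0.
    by apply: nbhs_right_lt; rewrite divr_gt0.
  move=> [z d]/= [xz dr] y zy.
  have h1 : `|g x - g z| <= e / 2 by apply: rg; move: xz; rewrite /ball/=; lra.
  have h2 : `|g x - g y| <= e / 2.
    apply: rg; move: xz; rewrite /ball/= => xz.
    rewrite (_ : x - y = (x - z) + (z - y)); last by ring.
    by apply: le_lt_trans (ler_normD _ _) _; lra.
  by move: h1 h2; rewrite !ler_norml; lra.
have [d [dP d0]] := filter_ex (filterI H (nbhs_right_gt (0:R))).
exists d => // x y x01 _; apply: dP; rewrite /= in_itv/=; lra.
Qed.

(** Once 2^N d >= 1, the iterate oscillates by at most e on all of [0,1], so it stays within e of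
    its mean, which is the integral of g. *)
Lemma transfer_ergodic_continuous g (e : R) : continuous g -> integrable01 g ->
  0 < e -> exists N, forall t, 0 <= t <= 1 ->
    `|iter N transfer g t - \int[mu]_(u in `[0%R, 1%R]) g u| <= e.
Proof.
move=> cg ig e0; have [d d0 gd] := unif_continuous01 cg e0.
have [N Nd] : exists N, 1 <= 2 ^+ N * d.
  exists (Num.truncn d^-1).+1; rewrite -ler_pdivrMr// mul1r.
  apply: ltW; apply: lt_le_trans (truncnS_gt _) _.
  by rewrite -natrX ler_nat ltnW// ltn_expl.
exists N => t t01.
have osc u : 0 <= u <= 1 -> `|iter N transfer g t - iter N transfer g u| <= e.
  move=> u01; apply: (iter_transfer_modulus gd) => //.
  by apply: le_trans Nd; rewrite ler_norml; lra.
rewrite -(Rintegral_iter_transfer N ig).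
have iN := integrable_iter_transfer N ig.
rewrite ler_norml; apply/andP; split.
- rewrite lerBrDr addrC lerBlDr -[leRHS]Rintegral01_cst.
  apply: le_Rintegral => //; first exact: integrable01_cst.
  move=> u; rewrite /= in_itv/= => /osc; rewrite ler_norml; lra.
- rewrite lerBlDr addrC -lerBlDr -[leLHS]Rintegral01_cst.
  apply: le_Rintegral => //; first exact: integrable01_cst.
  move=> u; rewrite /= in_itv/= => /osc; rewrite ler_norml; lra.
Qed.

(* Approximate [h] in L_1 by a continuous function, whose modulus of continuity
   is stretched by a factor 2 under each averaging. *)
Lemma transfer_ergodic h (e : R) : integrable01 h -> 0 < e -> exists N,
  \int[mu]_(t in `[0%R, 1%R])
    `|iter N transfer h t - \int[mu]_(u in `[0%R, 1%R]) h u| <= e.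
Proof.
move=> ih e0.
(* Three errors: the iterate of h - g, the distance of the iterate of g from its mean, and the
   difference of the two means. *)
have e30 : 0 < e / 3 by rewrite divr_gt0.
have fin01 : (mu `[0%R, 1%R]%classic < +oo)%E.
  by rewrite measure01 ltry.
have [g_ [cg ig gh]] := approximation_continuous_integrable
  (measurable_itv _) fin01 ih.
have [n gn] : exists n, \int[mu]_(t in `[0%R, 1%R]) `|h t - g_ n t| <= e / 3.
  move/fine_cvgP : gh => [_ /cvgrPdist_le/(_ _ e30)[n _ gn]].
  exists n; apply: le_trans (gn n (leqnn n)).
  by rewrite sub0r normrN ger0_norm//; apply: Rintegral_ge0.
move: (g_ n) (cg n) (ig n) gn => g {}cg {}ig hg {gh g_}.
have [N gN] := transfer_ergodic_continuous cg ig e30.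
exists N.
have ihg : integrable01 (fun t => h t - g t).
  by apply: (@integrableB _ _ _ mu _ _ (EFin \o h) (EFin \o g)).
have ihN : integrable01 (fun t => `|iter N transfer (fun t => h t - g t) t|).
  exact/integrable01_norm/integrable_iter_transfer.
apply: (@le_trans _ _ (\int[mu]_(t in `[0%R, 1%R])
   (`|iter N transfer (fun t => h t - g t) t| + (e / 3 + e / 3)))); last first.
  rewrite RintegralD//; last exact: integrable01_cst.
  rewrite Rintegral01_cst.
  by have := le_trans (Rintegral_norm_iter_transfer N ihg) hg; lra.
apply: le_Rintegral => //.
- apply: integrable01_norm; apply: integrable01D; last exact: integrable01_cst.
  exact: integrable_iter_transfer.
- by apply: integrable01D => //; exact: integrable01_cst.
move=> t; rewrite /= in_itv/= => /gN.
have : `|\int[mu]_(t in `[0%R, 1%R]) h t - \int[mu]_(t in `[0%R, 1%R]) g t| <= e / 3.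
  rewrite -RintegralB//; apply: le_trans hg; exact: le_normr_Rintegral.
rewrite iter_transferB.
set x := iter N transfer h t; set y := iter N transfer g t.
set p := Rintegral _ _ _; set q := Rintegral _ _ _.
move=> h1 h2.
rewrite (_ : x - p = (x - y) + ((y - q) - (p - q))); last by ring.
apply: le_trans (ler_normD _ _) _; rewrite lerD2l.
by apply: le_trans (ler_normB _ _) _; rewrite addrC; lra.
Qed.

End ergodic.

(** * Symmetric seminorms *)

(** This class is stable under passing from [rho] to [fun h => rho (V1 h)], whereas the
    normalization is lost; inductions on the rank can therefore let [rho] vary. *)
Record symmetric_seminorm (R : realType) (rho : (R -> R) -> \bar R) : Prop := {
  sn_ge0 : forall x, meas01 x -> (0 <= rho x)%E;
  sn_hom : forall (a : R) x, meas01 x ->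
      rho (fun t => a * x t) = (`|a|%:E * rho x)%E;
  sn_tri : forall x y, meas01 x -> meas01 y ->
      (rho (fun t => (x t + y t)%R) <= rho x + rho y)%E;
  sn_ideal : forall x y, meas01 x -> meas01 y ->
      ae01 (fun t => `|x t| <= `|y t|) -> (rho x <= rho y)%E;
  sn_sym : forall x y, meas01 x -> meas01 y -> equimeasurable x y -> rho x = rho y }.

Section seminorm.
Context {R : realType}.
Implicit Types (a b h g f x y : R -> R) (rho : (R -> R) -> \bar R).
Local Notation mu := (@lebesgue_measure R).

Lemma symmetric_space_seminorm rho : symmetric_space rho -> symmetric_seminorm rho.
Proof. by case=> *; split. Qed.

Lemma measurable_gt (s : R) : measurable [set r : R | s < r].
Proof. by rewrite -set_itvoy; exact: measurable_itv. Qed.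

Lemma dist_joinh_gt a b (s : R) : meas01 a -> meas01 b ->
  mu (`[0%R, 1%R]%classic `&` [set t | s < joinh a b t]) =
  (2^-1%:E * (mu (`[0%R, 1%R]%classic `&` [set t | (s < a t)%R]) +
              mu (`[0%R, 1%R]%classic `&` [set t | (s < b t)%R])))%E.
Proof. by move=> ma mb; exact: (dist_joinh ma mb (measurable_gt s)). Qed.

Lemma equimeasurable_joinhC a b : meas01 a -> meas01 b ->
  equimeasurable (joinh a b) (joinh b a).
Proof. by move=> ma mb s; rewrite !dist_joinh_gt// addeC. Qed.

Lemma equimeasurable_joinhh a : meas01 a -> equimeasurable (joinh a a) a.
Proof.
move=> ma s; rewrite dist_joinh_gt// -[X in (X + X)%E]mul1e -ge0_muleDl ?lee01//.
by rewrite muleA -EFinD -EFinM mulVf// mul1e.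
Qed.

Lemma equimeasurable_joinh a a' b b' : meas01 a -> meas01 b -> meas01 a' -> meas01 b' ->
  equimeasurable a a' -> equimeasurable b b' -> equimeasurable (joinh a b) (joinh a' b').
Proof. by move=> ma mb ma' mb' aa bb s; rewrite !dist_joinh_gt// aa bb. Qed.

Lemma meas01_cst (r : R) : meas01 (fun=> r).
Proof. exact: measurable_cst. Qed.

Lemma meas01_V1 h : meas01 h -> meas01 (V1 h).
Proof. by move=> mh; exact: (meas01_joinh (meas01_cst 0) mh). Qed.

Lemma meas01_V0 h : meas01 h -> meas01 (V0 h).
Proof.
move=> mh; apply: measurable_fun_if => //; first exact: measurable_fun_ler.
rewrite (_ : (fun t => h (2 * t)) = fun t => h (aff 2 0 t)); last first.
  by apply/funext => t; rewrite /aff addr0.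
by apply: measurable_comp_aff => // t [] /=; rewrite !in_itv/= /aff; lra.
Qed.

(** The symmetry axiom survives because [V1 h] is a join of 0 and [h], and joins respect
    equimeasurability. *)
Lemma seminorm_V1 rho : symmetric_seminorm rho -> symmetric_seminorm (fun h => rho (V1 h)).
Proof.
move=> S; split.
- by move=> x mx; apply: (sn_ge0 S); exact: meas01_V1.
- move=> a x mx; rewrite -(sn_hom S)//; last exact: meas01_V1.
  by congr rho; apply/funext => t; rewrite /V1; case: ifP; rewrite ?mulr0.
- move=> x y mx my.
  rewrite (_ : V1 (fun t => x t + y t) = fun t => V1 x t + V1 y t).
    by apply: (sn_tri S); exact: meas01_V1.
  by apply/funext => t; rewrite /V1; case: ifP; rewrite ?addr0.
- move=> x y mx my xy; apply: (sn_ideal S); try exact: meas01_V1.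
  apply: (ae01_aff (d := -1) (ltr0n _ 2) xy) => t t01; rewrite /V1 /=; case: ltP => // t2.
  by apply; move: t01; rewrite /= !in_itv/= /aff; lra.
- move=> x y mx my xy; apply: (sn_sym S); try exact: meas01_V1.
  by apply: (equimeasurable_joinh (meas01_cst 0) mx (meas01_cst 0) my).
Qed.

Variable rho : (R -> R) -> \bar R.
Hypothesis S : symmetric_seminorm rho.

Lemma sn_ae_eq x y : meas01 x -> meas01 y -> ae01 (fun t => x t = y t) -> rho x = rho y.
Proof.
move=> mx my xy; apply/eqP; rewrite eq_le; apply/andP; split; apply: (sn_ideal S) => //.
- by apply: (ae01_mono xy) => t _ ->.
- by apply: (ae01_mono xy) => t _ ->.
Qed.

(* V_0 h and V_1 h overlap at t = 1/2, so V_0 h is a join only almost everywhere. *)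
Lemma sn_V0V1 h : meas01 h -> rho (V0 h) = rho (V1 h).
Proof.
move=> mh; have m0 := meas01_cst 0.
rewrite V1E (sn_sym S (meas01_joinh m0 mh) (meas01_joinh mh m0) (equimeasurable_joinhC m0 mh)).
apply: sn_ae_eq; [exact: meas01_V0|exact: meas01_joinh|].
apply: (@ae01_neq _ 2^-1) => t t01 t2; rewrite /V0 /joinh le_eqVlt (negbTE t2)/=.
by rewrite /aff addr0.
Qed.

(* [joinh (T h) (T h)] is equimeasurable with [T h] and is the mean of [h] and
   of [h] with its halves swapped. *)
Lemma sn_transfer h : meas01 h -> (rho (transfer h) <= rho h)%E.
Proof.
move=> mh; have ml := meas01_lhalf mh; have mr := meas01_rhalf mh.
have mt := meas01_transfer mh.
rewrite -(sn_sym S (meas01_joinh mt mt) mt (equimeasurable_joinhh mt)).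
have -> : joinh (transfer h) (transfer h) =
    fun t => 2^-1 * joinh (lhalf h) (rhalf h) t + 2^-1 * joinh (rhalf h) (lhalf h) t.
  by apply/funext => t; rewrite /joinh /transfer; case: ifP => // _; rewrite addrC.
have m1 := meas01_joinh ml mr; have m2 := meas01_joinh mr ml.
apply: le_trans (sn_tri S _ _) _; try exact: measurable_funM.
rewrite !(sn_hom S)// (sn_sym S m2 m1); last exact: equimeasurable_joinhC.
rewrite joinhK ger0_norm// -ge0_muleDl ?lee_fin// -EFinD.
by rewrite (_ : 2^-1 + 2^-1 = 1 :> R) ?mul1e//; lra.
Qed.

Lemma meas01_iter_transfer N h : meas01 h -> meas01 (iter N transfer h).
Proof. by move=> mh; elim: N => //= N; exact: meas01_transfer. Qed.

Lemma sn_iter_transfer N h : meas01 h -> (rho (iter N transfer h) <= rho h)%E.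
Proof.
move=> mh; elim: N => //= N; apply: le_trans.
by apply: sn_transfer; exact: meas01_iter_transfer.
Qed.


(** * Continuity of integration for a symmetric seminorm *)

Lemma meas01_indic (c : R) : meas01 (indic01 c).
Proof.
apply: measurable_funTS; apply: measurable_fun_ifT => //.
apply: measurable_and; exact: measurable_fun_ler.
Qed.

Lemma meas01_indicator (E : set R) : measurable E -> meas01 (\1_E : R -> R).
Proof. by move=> mE; apply: measurable_funTS; exact: measurable_indic. Qed.

(** The indicator of E is equimeasurable with that of [0, m], where m >= 1/2 is the measure of E;
    the latter dominates [V0] of 1, which has the same seminorm as [V1] of 1. *)
Lemma sn_indicator_ge (E : set R) : measurable E -> E `<=` `[0%R, 1%R]%classic ->
  ((2^-1)%:E <= mu E)%E -> (rho (V1 (fun=> 1%R)) <= rho (\1_E : R -> R))%E.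
Proof.
move=> mE E01 E2.
have finE : mu E \is a fin_num.
  rewrite ge0_fin_numE//; apply: (@le_lt_trans _ _ (mu `[0%R, 1%R]%classic)).
    by apply: le_measure; rewrite ?inE.
  by rewrite measure01 ltry.
pose m := fine (mu E).
have muE : mu E = m%:E by rewrite fineK.
have m2 : 2^-1 <= m by rewrite -lee_fin -muE.
have m1 : m <= 1.
  by rewrite -lee_fin -muE -measure01; apply: le_measure; rewrite ?inE.
have -> : rho (\1_E : R -> R) = rho (indic01 m).
  apply: (sn_sym S (meas01_indicator mE) (meas01_indic m)) => s.
  have [s0|s0] := ltP s 0.
    congr (mu _); apply/seteqP; split => t /= [t01 _]; split => //.
      by rewrite /indic01; case: ifP => _ //; apply: lt_trans s0 _.
    by rewrite indicE; apply: lt_le_trans s0 _.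
  have [s1|s1] := ltP s 1.
    rewrite (_ : _ `&` _ = E); last first.
      apply/seteqP; split => t /=; rewrite indicE.
        by case: (boolP (t \in E)) => [/set_mem//|_ /= [_]]; rewrite ltNge s0.
      by move=> Et; rewrite mem_set//; split => //; exact: E01.
    rewrite muE (_ : _ `&` _ = `[0, m]%classic); last first.
      apply/seteqP; split => t /=; rewrite !in_itv/= /indic01.
        by case: ifP => // _ [_]; rewrite ltNge s0.
      by move=> tm; rewrite tm; split => //; lra.
    by rewrite lebesgue_measure_itv/= lte_fin oppr0 adde0 ifT//; lra.
  congr (mu _); apply/seteqP; split => t /= [t01]; rewrite /indic01 ?indicE.
  - by case: (_ \in _); rewrite ltNge ?s1//= s0.
  - by case: ifP; rewrite ltNge ?s1//= s0.
rewrite -sn_V0V1//; last exact: meas01_cst.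
apply: (sn_ideal S); [by apply: meas01_V0; exact: meas01_cst|exact: meas01_indic|].
apply: ae01_oo => t t0 t1; rewrite /V0 /indic01.
case: (leP t 2^-1) => t2; last by rewrite normr0.
by rewrite ifT// (ltW t0)/=; lra.
Qed.

(** Some iterate of T brings h close in L_1 to its mean a, so the iterate is at least |a|/2 in
    modulus on a set of measure at least 1/2; and T does not increase the seminorm. *)
Lemma sn_Rintegral h : integrable01 h ->
  ((`|\int[mu]_(t in `[0%R, 1%R]) h t| / 2)%:E * rho (V1 (fun=> 1%R)) <= rho h)%E.
Proof.
move=> ih; set a := Rintegral _ _ _.
have mh : meas01 h by move/integrableP : ih => [/measurable_EFinP].
have [->|a0] := eqVneq a 0.
  by rewrite normr0 mul0r mul0e; exact: (sn_ge0 S).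
have {}a0 : 0 < `|a| by rewrite normr_gt0.
(* By Chebyshev, an L_1 error of |a|/4 allows a deviation of |a|/2 or more only on a set of measure
   at most 1/2. *)
have a40 : 0 < `|a| / 4 by rewrite divr_gt0.
have [N] := transfer_ergodic ih a40.
rewrite -/a.
have := sn_iter_transfer N mh.
have := integrable_iter_transfer N ih.
have := meas01_iter_transfer N mh.
move: (iter N transfer h) => H mH iH Hh Ha.
apply: le_trans Hh.
pose E := `[0%R, 1%R]%classic `&` [set t | `|a| / 2 <= `|H t|].
have mge (g : R -> R) (r : R) : meas01 g ->
    measurable (`[0%R, 1%R]%classic `&` [set t | r <= `|g t|]).
  move=> mg; have mr : measurable [set x : R | r <= x].
    by rewrite -set_itvcy; exact: measurable_itv.
  have mng : meas01 (fun t => `|g t|).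
    exact: (measurableT_comp (@normr_measurable R setT) mg).
  exact: (mng (measurable_itv _) _ mr).
have mE : measurable E by exact: mge.
have E2 : ((2^-1)%:E <= mu E)%E.
  have iHa : integrable01 (fun t => H t - a).
    by apply: integrable01D => //; exact: integrable01_cst.
  have mHa : meas01 (fun t => H t - a) by move/integrableP : iHa => [/measurable_EFinP].
  pose E' := `[0%R, 1%R]%classic `&` [set t | `|a| / 2 <= `|H t - a|].
  have mE' : measurable E' by exact: mge.
  have E'2 : (mu E' <= (2^-1)%:E)%E.
    have a20 : 0 < `|a| / 2 by rewrite divr_gt0.
    rewrite -(@lee_pmul2l _ (`|a| / 2)%:E)//.
    apply: (@le_trans _ _ (\int[mu]_(t in `[0%R, 1%R]) `|(H t - a)%:E|)%E).
      have [mk _] := integrableP _ _ _ iHa.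
      have := le_integral_abse mu (measurable_itv _) mk a20.
      by apply: le_trans; rewrite lee_pmul2l.
    rewrite -[leLHS]fineK; last first.
      by apply: integrable_fin_num => //; exact: (integrable01_norm iHa).
    rewrite lee_fin; apply: le_trans Ha _; lra.
  have : (1 <= mu E + mu E')%E.
    rewrite -measure01; apply: le_trans (measureU2 mu mE mE').
    apply: le_measure; rewrite ?inE//; first exact: measurableU.
    move=> t t01; case: (leP (`|a| / 2) `|H t|) => Ht; first by left.
    right; split => //=; have := ler_distD 0 (H t) a; rewrite !sub0r subr0 normrN.
    have := ler_normD (a - H t) (H t); rewrite subrK distrC; lra.
  move=> h1; have : (1 <= mu E + 2^-1%:E)%E by apply: le_trans h1 _; rewrite leeD2l.
  rewrite -leeBlDr// -EFinB; apply: le_trans; rewrite lee_fin; lra.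
apply: (@le_trans _ _ ((`|a| / 2)%:E * rho (\1_E : R -> R))%E).
  rewrite lee_pmul2l// ?lte_fin ?divr_gt0//.
  by apply: sn_indicator_ge => // t [].
have a20 : 0 <= `|a| / 2 by rewrite divr_ge0.
rewrite -[X in (X%:E * _)%E](ger0_norm a20) -(sn_hom S); last exact: meas01_indicator.
apply: (sn_ideal S) => //; first by apply: measurable_funM => //; exact: meas01_indicator.
apply: ae01_oo => t t0 t1; rewrite indicE normrM.
case: (boolP (t \in E)) => [/set_mem [_ /=]|_]; last by rewrite normr0 mulr0.
by rewrite normr1 mulr1 (ger0_norm a20).
Qed.

End seminorm.

(** * Blocks of the representing system *)

Section blocks.
Context {R : realType}.
Implicit Types (a b h g f x y : R -> R) (rho : (R -> R) -> \bar R) (xi : seq bool -> R).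
Local Notation mu := (@lebesgue_measure R).

Lemma block0 xi f t : block xi f 0 t = xi [::] * f t.
Proof.
transitivity (\sum_(a : 0.-tuple bool) xi [::] * f t).
  by apply: eq_bigr => s _; rewrite tuple0.
by rewrite sumr_const card_tuple card_bool expn0 mulr1n.
Qed.

(** The first letter of a word selects the half, and the remaining letters index a block of rank k
    inside it. *)
Lemma blockS xi f k t : block xi f k.+1 t =
  V0 (block (fun s => xi (false :: s)) f k) t + V1 (block (fun s => xi (true :: s)) f k) t.
Proof.
rewrite /block.
rewrite (reindex (fun p : bool * k.-tuple bool => [tuple of p.1 :: p.2])) /=; last first.
  exists (fun s : k.+1.-tuple bool => (thead s, [tuple of behead s])) => [[b s]|s] _ /=.
    by congr pair; apply/val_inj.
  by rewrite [RHS]tuple_eta.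
rewrite -(pair_bigA _ (fun (b : bool) (s : k.-tuple bool) =>
  xi (b :: s) * Vb b (Valpha s f) t)) /=.
rewrite big_bool /= addrC /V0 /V1; congr (_ + _).
- by case: ifP => // _; rewrite big1// => s _; rewrite mulr0.
- by case: ifP => // _; rewrite big1// => s _; rewrite mulr0.
Qed.

Lemma meas01_block xi f k : meas01 f -> meas01 (block xi f k).
Proof.
move=> mf; elim: k xi => [|k IH] xi.
  rewrite (_ : block xi f 0 = fun t => xi [::] * f t); last exact/funext/block0.
  exact: measurable_funM.
rewrite (_ : block xi f k.+1 = fun t =>
  V0 (block (fun s => xi (false :: s)) f k) t +
  V1 (block (fun s => xi (true :: s)) f k) t); last exact/funext/blockS.
by apply: measurable_funD; [exact: meas01_V0|exact: meas01_V1].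
Qed.

(** On [0,1] both [V0 h] and [V1 h] are the extension of h by zero composed with an affine map. *)
Let integrable_zoom (d : R) h (V : R -> R) : integrable01 h ->
  (forall t, 0 <= t <= 1 -> V t = (h \_ `[0%R, 1%R]%classic) (aff 2 d t)) ->
  integrable01 V.
Proof.
move=> ih hV.
have i2 : mu.-integrable setT (EFin \o (h \_ `[0%R, 1%R]%classic)).
  by rewrite -restrict_EFin; apply: (integrable_mkcond _ _).1; first exact: measurable_itv.
have i3 := integrable_aff d (ltr0n _ 2) measurableT i2.
have i4 : integrable01 (fun t => (h \_ `[0%R, 1%R]%classic) (aff 2 d t)).
  by apply: integrableS i3 => //; exact: measurable_aff_preimage.
apply: eq_integrable i4 => //.
by move=> t /set_mem; rewrite /= in_itv/= => /hV ->.
Qed.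

Lemma integrable_V0 h : integrable01 h -> integrable01 (V0 h).
Proof.
move=> ih; apply: (integrable_zoom (d := 0) ih) => t t01.
rewrite /V0 patchE /aff addr0; case: ifPn => t2.
  by rewrite mem_set//= in_itv/=; lra.
by rewrite memNset//= in_itv/=; lra.
Qed.

Lemma integrable_V1 h : integrable01 h -> integrable01 (V1 h).
Proof.
move=> ih; apply: (integrable_zoom (d := -1) ih) => t t01.
rewrite /V1 patchE /aff; case: ifPn => t2.
  by rewrite memNset//= in_itv/=; lra.
by rewrite mem_set//= in_itv/=; lra.
Qed.

Lemma integrable_block xi f k : integrable01 f -> integrable01 (block xi f k).
Proof.
move=> mf; elim: k xi => [|k IH] xi.
  rewrite (_ : block xi f 0 = fun t => xi [::] * f t); last exact/funext/block0.
  exact: integrable01Z.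
rewrite (_ : block xi f k.+1 = fun t =>
  V0 (block (fun s => xi (false :: s)) f k) t +
  V1 (block (fun s => xi (true :: s)) f k) t); last exact/funext/blockS.
by apply: integrable01D; [exact: integrable_V0|exact: integrable_V1].
Qed.

(** The endpoint t = 0 is excluded because it corresponds to 1/2, where the copies under [V0] and
    [V1] both contribute. *)
Lemma rhalf_block xi f k t : 0 < t < 1 ->
  rhalf (block xi f k.+1) t = block (fun s => xi (true :: s)) f k t.
Proof.
move=> t01; rewrite /rhalf blockS /V0 /V1 /aff ifF; last by apply/negbTE; lra.
rewrite ifF; last by apply/negbTE; lra.
by rewrite add0r; congr block; lra.
Qed.

Lemma lhalf_block xi f k t : 0 < t < 1 ->
  lhalf (block xi f k.+1) t = block (fun s => xi (false :: s)) f k t.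
Proof.
move=> t01; rewrite /lhalf blockS /V0 /V1 /aff ifT; last by lra.
by rewrite ifT ?addr0; [congr block|]; lra.
Qed.

(** One averaging lowers the rank by one and averages the coefficients of words that differ only in
    the first letter; k of them turn a block of rank k into a multiple of f. *)
Lemma transfer_block xi f k t : 0 < t < 1 ->
  transfer (block xi f k.+1) t =
  block (fun s => 2^-1 * xi (false :: s) + 2^-1 * xi (true :: s)) f k t.
Proof.
move=> t01; rewrite /transfer rhalf_block// lhalf_block// /block !mulr_sumr -big_split/=.
by apply: eq_bigr => s _; ring.
Qed.

Lemma Rintegral01_ae x y : meas01 x -> meas01 y -> ae01 (fun t => x t = y t) ->
  \int[mu]_(t in `[0%R, 1%R]) x t = \int[mu]_(t in `[0%R, 1%R]) y t.
Proof.
move=> mx my xy; rewrite /Rintegral; congr fine; apply: ae_eq_integral => //.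
- exact/measurable_EFinP.
- exact/measurable_EFinP.
- by apply: (ae01_mono xy) => t _ ->.
Qed.

Lemma Rintegral01_le x y : integrable01 x -> integrable01 y ->
  ae01 (fun t => x t <= y t) ->
  \int[mu]_(t in `[0%R, 1%R]) x t <= \int[mu]_(t in `[0%R, 1%R]) y t.
Proof.
move=> ix iy xy.
have mx : meas01 x by move/integrableP : ix => [/measurable_EFinP].
have my : meas01 y by move/integrableP : iy => [/measurable_EFinP].
have md : meas01 (fun t => y t - x t) by exact: measurable_funB.
rewrite -subr_ge0 -RintegralB//.
rewrite (Rintegral01_ae (y := fun t => `|y t - x t|) md); first exact: Rintegral_ge0.
- exact: (measurableT_comp (@normr_measurable R setT) md).
- by apply: (ae01_mono xy) => t _ h; rewrite ger0_norm// subr_ge0.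
Qed.

Lemma ae01_iter_rhalf x y n : ae01 (fun t => x t <= y t) ->
  ae01 (fun t => iter n rhalf x t <= iter n rhalf y t).
Proof.
move=> xy; elim: n => //= n IH.
apply: (@ae01_aff _ 2^-1 2^-1 _ _ _ IH) => // t t01; apply.
by move: t01; rewrite /= !in_itv/= /aff; lra.
Qed.

Lemma ae01_eq_iter_rhalf x y n : ae01 (fun t => x t = y t) ->
  ae01 (fun t => iter n rhalf x t = iter n rhalf y t).
Proof.
move=> xy; elim: n => //= n IH.
apply: (@ae01_aff _ 2^-1 2^-1 _ _ _ IH) => // t t01; apply.
by move: t01; rewrite /= !in_itv/= /aff; lra.
Qed.

Lemma meas01_iter_rhalf n h : meas01 h -> meas01 (iter n rhalf h).
Proof. by move=> mh; elim: n => //= n; exact: meas01_rhalf. Qed.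

Lemma integrable_iter_rhalf n h : integrable01 h -> integrable01 (iter n rhalf h).
Proof. by move=> mh; elim: n => //= n; exact: integrable_rhalf. Qed.

Lemma meas01_iter_V1 n h : meas01 h -> meas01 (iter n (@V1 R) h).
Proof. by move=> mh; elim: n => //= n; exact: meas01_V1. Qed.

Lemma meas01_iter_V0 n h : meas01 h -> meas01 (iter n (@V0 R) h).
Proof. by move=> mh; elim: n => //= n; exact: meas01_V0. Qed.

(** * Block estimates for a decreasing generator *)

Section decreasing.
Variable f : R -> R.
(** Almost-everywhere consequences of f = f^*: nonnegativity and comparison of f with its stretched
    right half and its compressed copy. In this form [sn_iter_V1_le] applies to the constant 1 as
    well. *)
Hypotheses (fint : integrable01 f) (f_ge0 : ae01 (fun t => 0 <= f t))
  (f_rhalf : ae01 (fun t => rhalf f t <= f t))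
  (f_V0 : ae01 (fun t => `|V0 f t| <= `|f t|)).

Let mf : meas01 f.
Proof. by move/integrableP : fint => [/measurable_EFinP]. Qed.

(** The induction hypothesis for the seminorm [rho] after [V1] leaves a single [V1], which is traded
    for [V0]; and [V0 f] is dominated by f. *)
Lemma sn_iter_V1_le rho n : symmetric_seminorm rho -> (rho (iter n (@V1 R) f) <= rho f)%E.
Proof.
elim: n rho => //= n IH rho S.
apply: le_trans (IH _ (seminorm_V1 S)) _.
rewrite -sn_V0V1//; apply: (sn_ideal S) => //; exact: meas01_V0.
Qed.

Lemma iter_rhalf_ge0 n : ae01 (fun t => 0 <= iter n rhalf f t).
Proof.
have := ae01_iter_rhalf n f_ge0.
by rewrite (_ : iter n rhalf (fun=> 0) = fun=> 0)//; elim: n => //= n ->.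
Qed.

Lemma iter_rhalf_le n : ae01 (fun t => iter n rhalf f t <= f t).
Proof.
elim: n => [|n IH]; first by apply: ae01_oo.
have := ae01_iter_rhalf n f_rhalf; rewrite -iterSr => h.
by apply: (ae01_mono2 h IH) => t _; exact: le_trans.
Qed.

Lemma Rintegral_iter_rhalf n :
  `|\int[mu]_(t in `[0%R, 1%R]) iter n rhalf f t| <= \int[mu]_(t in `[0%R, 1%R]) f t.
Proof.
rewrite ger0_norm.
  apply: Rintegral01_le (iter_rhalf_le n) => //; exact: integrable_iter_rhalf.
rewrite -[leLHS](Rintegral01_cst (0 : R)).
apply: Rintegral01_le (iter_rhalf_ge0 n); first exact: integrable01_cst.
exact: integrable_iter_rhalf.
Qed.

(** Two moves lower the rank: cutting to the right half while n > 0, with [rho] replaced by [rho]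
    after [V1], and averaging once n = 0. Neither changes the integral on the left nor increases the
    norm on the right. *)
Lemma Rintegral_block_bound rho n xi k : symmetric_seminorm rho ->
  (`|\int[mu]_(t in `[0%R, 1%R]) iter n rhalf (block xi f k) t|%:E * rho (iter n (@V1 R) f) <=
   (\int[mu]_(t in `[0%R, 1%R]) f t)%:E * rho (block xi f k))%E.
Proof.
have I0 : 0 <= \int[mu]_(t in `[0%R, 1%R]) f t.
  exact: le_trans (Rintegral_iter_rhalf 0).
(* Both moves end at rank 0, a multiple of f, possibly with cuts still to be made; then the final
   piece of f has integral at most that of f, and its seminorm is likewise bounded. *)
have base (rho' : (R -> R) -> \bar R) m zeta : symmetric_seminorm rho' ->
  (`|\int[mu]_(t in `[0%R, 1%R]) iter m rhalf (block zeta f 0) t|%:E * rho' (iter m (@V1 R) f) <=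
   (\int[mu]_(t in `[0%R, 1%R]) f t)%:E * rho' (block zeta f 0))%E.
  move=> S'.
  have -> : block zeta f 0 = fun t => zeta [::] * f t by exact/funext/block0.
  have -> : iter m rhalf (fun t => zeta [::] * f t) = fun t => zeta [::] * iter m rhalf f t.
    by elim: m => //= m ->.
  rewrite RintegralZl//; last exact: integrable_iter_rhalf.
  rewrite (sn_hom S')// normrM EFinM -muleA [leRHS]muleCA.
  apply: lee_wpmul2l => //; apply: lee_pmul => //.
  - by apply: (sn_ge0 S'); exact: meas01_iter_V1.
  - by rewrite lee_fin; exact: Rintegral_iter_rhalf.
  - exact: sn_iter_V1_le.
elim: n rho xi k => [|n IH] rho xi k S.
  elim: k xi => [|k IHk] xi; first exact: base.
  have ib : integrable01 (block xi f k.+1) by exact: integrable_block.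
  have mb : meas01 (block xi f k.+1) by exact: meas01_block.
  rewrite /= -(Rintegral_transfer ib).
  set eta := fun s => 2^-1 * xi (false :: s) + 2^-1 * xi (true :: s).
  have tb : ae01 (fun t => transfer (block xi f k.+1) t = block eta f k t).
    by apply: ae01_oo => t t0 t1; apply: transfer_block; rewrite t0.
  rewrite (Rintegral01_ae _ _ tb); [|exact: meas01_transfer|exact: meas01_block].
  apply: le_trans (IHk eta) _; apply: lee_wpmul2l; first by rewrite lee_fin.
  rewrite -(sn_ae_eq S _ _ tb); [exact: sn_transfer|exact: meas01_transfer|exact: meas01_block].
case: k => [|k]; first exact: base.
set eta := fun s => xi (true :: s).
have tb : ae01 (fun t => rhalf (block xi f k.+1) t = block eta f k t).
  by apply: ae01_oo => t t0 t1; apply: rhalf_block; rewrite t0.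
rewrite iterSr (Rintegral01_ae _ _ (ae01_eq_iter_rhalf n tb)); last 2 first.
- by apply: meas01_iter_rhalf; apply: meas01_rhalf; exact: meas01_block.
- by apply: meas01_iter_rhalf; exact: meas01_block.
apply: le_trans (IH _ eta k (seminorm_V1 S)) _.
apply: lee_wpmul2l; first by rewrite lee_fin.
apply: (sn_ideal S); [by apply: meas01_V1; exact: meas01_block|exact: meas01_block|].
apply: (@ae01_neq _ 2^-1) => t t01 t2; rewrite blockS {1}/V1.
case: ltP => t3; first by rewrite normr0.
rewrite /V0 ifF ?add0r /V1 ?ifF//; last by apply/negbTE; move: t2; rewrite neq_lt; lra.
by apply/negbTE; rewrite -leNgt.
Qed.

End decreasing.
End blocks.

(** * The bound for dyadic intervals *)

Section iterates.
Context {R : realType}.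
Implicit Types (h f x y : R -> R) (rho : (R -> R) -> \bar R).
Local Notation mu := (@lebesgue_measure R).

Lemma seminorm_iter_V1 rho n : symmetric_seminorm rho ->
  symmetric_seminorm (fun h => rho (iter n (@V1 R) h)).
Proof. by elim: n rho => //= n IH rho S; exact: (IH _ (seminorm_V1 S)). Qed.

(** Cutting n times and putting the piece back restricts h to the last dyadic interval of rank n. *)
Lemma sn_iter_V1_rhalf_le rho n h : symmetric_seminorm rho -> meas01 h ->
  (rho (iter n (@V1 R) (iter n rhalf h)) <= rho h)%E.
Proof.
elim: n rho h => //= n IH rho h S mh.
rewrite (_ : rhalf (iter n rhalf h) = iter n rhalf (rhalf h)); last by rewrite -iterSr.
apply: le_trans (IH _ _ (seminorm_V1 S) (meas01_rhalf mh)) _.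
apply: (sn_ideal S) => //; first by apply: meas01_V1; exact: meas01_rhalf.
apply: ae01_oo => t t0 t1; rewrite /V1; case: ltP => t2; first by rewrite normr0.
by rewrite (_ : rhalf h _ = h t)// /rhalf /aff; congr h; lra.
Qed.

Lemma iter_rhalf_V1 n h : ae01 (fun t => iter n rhalf (iter n (@V1 R) h) t = h t).
Proof.
elim: n => [|n IH]; first exact: ae01_oo.
rewrite iterSr iterS.
have e : ae01 (fun t => rhalf (V1 (iter n (@V1 R) h)) t = iter n (@V1 R) h t).
  apply: ae01_oo => t t0 t1; rewrite /rhalf /V1 /aff ifF; last by apply/negbTE; lra.
  by congr (iter n (@V1 R) h _); lra.
by apply: (ae01_mono2 (ae01_eq_iter_rhalf n e) IH) => t _ ->.
Qed.

Lemma sn_iter_V0V1 rho n h : symmetric_seminorm rho -> meas01 h ->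
  rho (iter n (@V0 R) h) = rho (iter n (@V1 R) h).
Proof.
elim: n rho => //= n IH rho S mh.
by rewrite sn_V0V1//; [exact: (IH _ (seminorm_V1 S))|exact: meas01_iter_V0].
Qed.

(** Off 1/2, the constant 1 is the sum of its two compressed copies, which have equal seminorm. This
    is the source of the factor 2 in the theorem. *)
Lemma sn_one_le_double rho : symmetric_seminorm rho ->
  (rho (fun=> 1%R) <= 2%:E * rho (V1 (fun=> 1%R)))%E.
Proof.
move=> S; have m1 := meas01_cst (1 : R).
rewrite (_ : 2%:E = 1%:E + 1%:E)%E; last by rewrite -EFinD.
rewrite ge0_muleDl// !mul1e -{1}(sn_V0V1 S m1).
apply: le_trans (sn_tri S (meas01_V0 m1) (meas01_V1 m1)).
apply: (sn_ideal S) => //; first by apply: measurable_funD; [exact: meas01_V0|exact: meas01_V1].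
apply: ae01_oo => t t0 t1; rewrite normr1 /V0 /V1.
case: (leP t 2^-1) => t2; case: (ltP t 2^-1) => t3; rewrite ?addr0 ?add0r ?normr1//.
- by rewrite ger0_norm; lra.
- by exfalso; lra.
Qed.

(** By the doubling inequality, a compression cannot annihilate the seminorm of 1. *)
Lemma sn_iter_V1_gt0 rho n : symmetric_seminorm rho -> (0 < rho (fun=> 1%R))%E ->
  (0 < rho (iter n (@V1 R) (fun=> 1%R)))%E.
Proof.
elim: n rho => //= n IH rho S r0; apply: (IH _ (seminorm_V1 S)).
rewrite lt_neqAle (sn_ge0 S) ?andbT; last by apply: meas01_V1; exact: meas01_cst.
apply/eqP => e; have := lt_le_trans r0 (sn_one_le_double S).
by rewrite -e mule0 ltxx.
Qed.

Lemma rearr_ge0 f t : (0 <= rearr f t)%E.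
Proof. by apply: le_ereal_inf_tmp => _ [s [s0 _] <-]; rewrite lee_fin. Qed.

Lemma rearr_nonincreasing f (s t : R) : s <= t -> (rearr f t <= rearr f s)%E.
Proof.
move=> st; apply: ereal_inf_le_tmp => _ [u [u0 us] <-]; exists u => //; split => //.
by apply: le_trans us _; rewrite lee_fin.
Qed.

Lemma meas01_partial_sum xi f n : meas01 f -> meas01 (partial_sum xi f n).
Proof.
move=> mf; elim: n => [|n IH].
  rewrite (_ : partial_sum xi f 0 = fun=> 0); first exact: meas01_cst.
  by apply/funext => t; rewrite /partial_sum big_ord0.
rewrite (_ : partial_sum xi f n.+1 = fun t => partial_sum xi f n t + block xi f n t).
  by apply: measurable_funD => //; exact: meas01_block.
by apply/funext => t; rewrite /partial_sum big_ord_recr.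
Qed.

Lemma sn_tri_partial_sum rho xi f n : symmetric_seminorm rho -> meas01 f ->
  (rho (partial_sum xi f n) <= \sum_(0 <= k < n) rho (block xi f k))%E.
Proof.
move=> S mf; elim: n => [|n IH].
  (* Zero is written as a multiple of 1 so that homogeneity yields seminorm 0. *)
  rewrite big_nil (_ : partial_sum xi f 0 = fun=> 0 * 1); last first.
    by apply/funext => t; rewrite /partial_sum big_ord0 mul0r.
  by rewrite (@sn_hom _ _ S 0 (fun=> 1) (meas01_cst 1)) normr0 mul0e.
rewrite big_nat_recr//=
  (_ : partial_sum xi f n.+1 = fun t => partial_sum xi f n t + block xi f n t); last first.
  by apply/funext => t; rewrite /partial_sum big_ord_recr.
apply: le_trans (sn_tri S _ _) _; [exact: meas01_partial_sum|exact: meas01_block|].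
by rewrite leeD2r.
Qed.

End iterates.

(** * The symmetric space and its representing system *)

Section bound.
Context {R : realType}.
Variables (rho : (R -> R) -> \bar R) (f : R -> R) (C : R).
Local Notation mu := (@lebesgue_measure R).
Hypotheses (X : symmetric_space rho) (fX : inX rho f)
  (f_rearr : ae01 (fun t => (f t)%:E = rearr f t)) (f_rep : abs_representing rho f C).

Let S := symmetric_space_seminorm X.
Let mf : meas01 f. Proof. by case: fX. Qed.
Let m1 := meas01_cst (1 : R).

Let f_ge0 : ae01 (fun t => 0 <= f t).
Proof. by apply: (ae01_mono f_rearr) => t _ ft; rewrite -lee_fin ft; exact: rearr_ge0. Qed.

(** As f agrees with its rearrangement only almost everywhere, monotonicity is available for almost
    every t along a fixed affine map: the exceptional set at the image point is pulled back. *)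
Lemma ae01_decreasing (c d : R) : 0 < c ->
  ae01 (fun t => 0 <= c * t + d <= 1 -> t <= c * t + d -> 0 <= f (c * t + d) <= f t).
Proof.
move=> c0; have fa : ae01 (fun t => D01 (aff c d t) ->
    (f (aff c d t))%:E = rearr f (aff c d t)).
  by apply: (ae01_aff (d := d) c0 f_rearr).
apply: (ae01_mono2 f_rearr fa) => t _ ft fct ct01 tct.
have {}fct : (f (c * t + d))%:E = rearr f (c * t + d) by apply: fct; rewrite /= in_itv.
rewrite -!lee_fin ft fct rearr_ge0 /=; exact: rearr_nonincreasing.
Qed.

Let f_rhalf : ae01 (fun t => rhalf f t <= f t).
Proof.
have h : 0 < (2^-1 : R) by [].
apply: (ae01_mono (ae01_decreasing 2^-1 h)) => t; rewrite /= in_itv/= => t01 ft.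
by have /andP[] : 0 <= f (2^-1 * t + 2^-1) <= f t by apply: ft; lra.
Qed.

Let f_V0 : ae01 (fun t => `|V0 f t| <= `|f t|).
Proof.
have h : 0 < (2 : R) by [].
apply: (ae01_mono (ae01_decreasing 0 h)) => t; rewrite /= in_itv/= addr0 => t01 ft.
rewrite /V0; case: ifPn => t2; last by rewrite normr0.
have /andP[f0 f1] : 0 <= f (2 * t) <= f t by apply: ft; lra.
by rewrite !ger0_norm// (le_trans f0 f1).
Qed.

Lemma symmetric_space_one : rho (fun=> 1%R) = 1%E.
Proof.
rewrite -(ss_norm X); apply: sn_ae_eq => //; first exact: meas01_indic.
by apply: ae01_oo => t t0 t1; rewrite /indic01 ifT//; lra.
Qed.

Let inX1 : inX rho (fun=> 1).
Proof. by split => //; rewrite symmetric_space_one ltry. Qed.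

(** If C <= 0, the partial sums for x = 1 all have norm 0, so the remainders have norm at least 1
    and cannot tend to 0. *)
Lemma representing_constant_gt0 : 0 < C.
Proof.
have [xi [cv le]] := f_rep inX1.
rewrite ltNge; apply/negP => C0.
have rb k : (0 <= rho (block xi f k))%E by apply: (sn_ge0 S); exact: meas01_block.
have s0 n : (rho (partial_sum xi f n) <= 0)%E.
  apply: le_trans (sn_tri_partial_sum _ _ S mf) _.
  apply: (@le_trans _ _ (\sum_(0 <= k <oo) rho (block xi f k))%E).
    by apply: nneseries_lim_ge.
  by apply: le_trans le _; rewrite symmetric_space_one mule1 lee_fin.
have ge1 n : (1 <= rho (fun t => (1 - partial_sum xi f n t)%R))%E.
  rewrite -symmetric_space_one -[leRHS]adde0; apply: le_trans (leeD2l _ (s0 n)).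
  have mp := meas01_partial_sum xi n mf.
  apply: le_trans (sn_tri S (measurable_funB m1 mp) mp).
  apply: (sn_ideal S) => //; first by apply: measurable_funD => //; exact: measurable_funB.
  by apply: ae01_oo => t _ _; rewrite subrK.
have : (1 <= (0 : \bar R))%E by apply: (cvge_to_ge cv); exact: nearW.
by rewrite lee_fin ler10.
Qed.

(** As f >= 0, integrability can fail only through an infinite integral; the theorem's right-hand
    side is then infinite. *)
Lemma integral_nonintegrable : ~ integrable01 f ->
  (\int[mu]_(t in `[0%R, 1%R]) (f t)%:E = +oo)%E.
Proof.
move=> nf.
have -> : (\int[mu]_(t in `[0%R, 1%R]) (f t)%:E = \int[mu]_(t in `[0%R, 1%R]) `|(f t)%:E|)%E.
  apply: ae_eq_integral => //; first exact/measurable_EFinP.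
    by apply: measurableT_comp => //; exact/measurable_EFinP.
  by apply: (ae01_mono f_ge0) => t _ ft; rewrite abse_EFin ger0_norm.
apply/eqP; rewrite -leye_eq leNgt; apply/negP => lty; apply: nf.
by apply/integrableP; split => //; exact/measurable_EFinP.
Qed.

Lemma iter_V1_one_le1 n : (rho (iter n (@V1 R) (fun=> 1%R)) <= 1)%E.
Proof.
rewrite -symmetric_space_one; apply: (sn_iter_V1_le (integrable01_cst 1)) => //.
apply: ae01_oo => t t0 t1; rewrite /V0 normr1.
by case: ifP => _; rewrite ?normr1 ?normr0.
Qed.

(** * Integrals of the remainder over the last dyadic interval *)

Section remainder.
Variables (n : nat) (xi : seq bool -> R).
Hypothesis fint : integrable01 f.
Let x := iter n (@V1 R) (fun=> 1).
Let b k := \int[mu]_(t in `[0%R, 1%R]) iter n rhalf (block xi f k) t.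

Lemma Rintegral_remainder N :
  integrable01 (fun t => x t - partial_sum xi f N t) /\
  \int[mu]_(t in `[0%R, 1%R]) iter n rhalf (fun t => x t - partial_sum xi f N t) t =
  1 - \sum_(0 <= k < N) b k.
Proof.
elim: N => [|N [iN IN]].
  rewrite big_nil subr0 (_ : (fun t => _) = x); last first.
    by apply/funext => t; rewrite /partial_sum big_ord0 subr0.
  split.
    by rewrite /x; elim: n => [|m]; [exact: integrable01_cst|exact: integrable_V1].
  rewrite (Rintegral01_ae _ _ (iter_rhalf_V1 n (fun=> 1)))//.
    exact: Rintegral01_cst.
  by apply: meas01_iter_rhalf; exact: meas01_iter_V1.
have ib := integrable_block xi N fint.
rewrite (_ : (fun t => x t - partial_sum xi f N.+1 t) =
  fun t => (x t - partial_sum xi f N t) - block xi f N t); last first.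
  by apply/funext => t; rewrite /partial_sum big_ord_recr opprD addrA.
split; first by apply: (@integrableB _ _ _ mu _ _ (EFin \o _) (EFin \o _)).
rewrite big_nat_recr//= opprD addrA -IN.
rewrite (_ : iter n rhalf (fun t => (x t - partial_sum xi f N t) - block xi f N t) =
  fun t => iter n rhalf (fun t => x t - partial_sum xi f N t) t - iter n rhalf (block xi f N) t).
  by rewrite RintegralB//; exact: integrable_iter_rhalf.
by elim: n => //= m ->.
Qed.

(** This is continuity of integration for rho_n, applied to the stretched last piece of the
    remainder. As the remainder tends to 0 in norm, it forces the [b k] to sum to 1. *)
Lemma remainder_bound N :
  ((`|1 - \sum_(0 <= k < N) b k| / 2)%:E * rho (iter n.+1 (@V1 R) (fun=> 1%R)) <=
   rho (fun t => (x t - partial_sum xi f N t)%R))%E.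
Proof.
have [iN IN] := Rintegral_remainder N.
rewrite -IN iterSr.
apply: le_trans (sn_Rintegral (seminorm_iter_V1 n S) (integrable_iter_rhalf n iN)) _.
apply: sn_iter_V1_rhalf_le => //.
by apply: measurable_funB; [exact: meas01_iter_V1|exact: meas01_partial_sum].
Qed.

End remainder.

Lemma iter_V1_bound n : integrable01 f ->
  (rho (iter n (@V1 R) f) <=
   (C * \int[mu]_(t in `[0%R, 1%R]) f t)%:E * rho (iter n (@V1 R) (fun=> 1%R)))%E.
Proof.
move=> fint; set I := Rintegral _ _ _.
have I0 : 0 <= I.
  have := Rintegral_iter_rhalf fint f_ge0 f_rhalf 0; exact: le_trans.
have sn_fin h r : meas01 h -> (rho h <= r)%E -> (r < +oo)%E -> rho h \is a fin_num.
  by move=> mh hr rlt; rewrite ge0_fin_numE ?(sn_ge0 S)//; exact: le_lt_trans hr rlt.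
have fF : rho (iter n (@V1 R) f) \is a fin_num.
  apply: sn_fin (sn_iter_V1_le fint f_V0 n S) _; first exact: meas01_iter_V1.
  by case: fX.
have fc m : rho (iter m (@V1 R) (fun=> 1)) \is a fin_num.
  by apply: sn_fin (iter_V1_one_le1 m) _; [exact: meas01_iter_V1|rewrite ltry].
have [xi [cv le]] : exists xi : seq bool -> R,
    (fun N => rho (fun t => iter n (@V1 R) (fun=> 1) t - partial_sum xi f N t)) @ \oo --> 0%E /\
    (\sum_(0 <= k <oo) rho (block xi f k) <= (C%:E * rho (iter n (@V1 R) (fun=> 1%R))))%E.
  apply: f_rep; split; first exact: meas01_iter_V1.
  by rewrite -ge0_fin_numE// (sn_ge0 S)//; exact: meas01_iter_V1.
have k0 : (0 < rho (iter n.+1 (@V1 R) (fun=> 1%R)))%E.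
  by apply: sn_iter_V1_gt0 => //; rewrite symmetric_space_one.
pose b k := \int[mu]_(t in `[0%R, 1%R]) iter n rhalf (block xi f k) t.
have bb k : (`|b k|%:E * rho (iter n (@V1 R) f) <= I%:E * rho (block xi f k))%E.
  exact: Rintegral_block_bound.
have rem := @remainder_bound n xi fint.
move: le.
rewrite -(fineK fF) -(fineK (fc n)).
set F := fine (rho (iter n (@V1 R) f)); set c := fine (rho (iter n (@V1 R) (fun=> 1))) => le.
have F0 : 0 <= F by rewrite fine_ge0// (sn_ge0 S)//; exact: meas01_iter_V1.
move: rem k0; rewrite -(fineK (fc n.+1)).
set k := fine (rho (iter n.+1 (@V1 R) (fun=> 1))) => rem.
rewrite lte_fin => k0.
(* Sum the block estimates and use the bound of the representing system on the total norm of the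
   blocks. *)
have sumb N : \sum_(0 <= k < N) (`|b k| * F) <= C * I * c.
  rewrite -lee_fin -sumEFin.
  apply: (@le_trans _ _ (\sum_(0 <= k < N) (I%:E * rho (block xi f k)))%E).
    by apply: lee_sum => i _; rewrite EFinM /F fineK//; exact: bb.
  have rb k' : (0 <= rho (block xi f k'))%E by apply: (sn_ge0 S); exact: meas01_block.
  have -> : (\sum_(0 <= k < N) (I%:E * rho (block xi f k)) =
      I%:E * \sum_(0 <= k < N) rho (block xi f k))%E by rewrite ge0_sume_distrr.
  rewrite (_ : C * I * c = I * (C * c)) ?EFinM; last by ring.
  apply: lee_wpmul2l; first by rewrite lee_fin.
  by apply: le_trans le; exact: nneseries_lim_ge.
rewrite -EFinM lee_fin; apply/ler_addgt0Pr => e e0.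
(* The target for |1 - sum of b|, so that its product with F is at most e; F may vanish, hence F +
   1. The factor k / 2 below matches the one in [remainder_bound]. *)
have e10 : 0 < e / (F + 1) by rewrite divr_gt0//; lra.
have ek0 : 0 < e / (F + 1) * (k / 2) by rewrite mulr_gt0// divr_gt0.
have [N rN] : exists N, (rho (fun t => (iter n (@V1 R) (fun=> 1) t - partial_sum xi f N t)%R) <
    (e / (F + 1) * (k / 2))%:E)%E.
  move/fine_cvgP : cv => [fin /cvgrPdist_lt/(_ _ ek0) dist].
  have [N [finN distN]] := filter_ex (filterI fin dist).
  exists N; rewrite -[ltLHS]fineK// lte_fin; move: distN => /=.
  rewrite sub0r normrN; apply: le_lt_trans; exact: ler_norm.
have := le_lt_trans (rem N) rN.
rewrite -EFinM lte_fin => r1.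
have {r1} bN : `|1 - \sum_(0 <= k < N) b k| <= e / (F + 1).
  move: r1; rewrite mulrAC -mulrA ltr_pM2r ?divr_gt0//; exact: ltW.
have eF : e / (F + 1) * F <= e.
  by rewrite mulrAC ler_pdivrMr; [nra|lra].
(* The triangle inequality for 1 = (1 - sum of b) + sum of b, multiplied by F. *)
have : F <= (`|1 - \sum_(0 <= k < N) b k| + \sum_(0 <= k < N) `|b k|) * F.
  rewrite -[leLHS]mul1r ler_wpM2r//.
  rewrite -[leLHS]normr1 -[X in `|X|](subrK (\sum_(0 <= k < N) b k)).
  by apply: le_trans (ler_normD _ _) _; rewrite lerD2l; exact: ler_norm_sum.
rewrite mulrDl mulr_suml => /le_trans; apply; rewrite addrC; apply: lerD => //.
by apply: le_trans eF; rewrite ler_wpM2r.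
Qed.

(** * From dyadic intervals to arbitrary t *)

Lemma iter_V0E n (h : R -> R) u : u <= 1 ->
  iter n (@V0 R) h u = if u <= 2 ^- n then h (2 ^+ n * u) else 0.
Proof.
(* For n = 0 the right-hand side is cut off at 1, which is why u <= 1 is assumed. *)
elim: n u => [|n IH] u u1; first by rewrite expr0 invr1 u1 mul1r.
rewrite iterS /V0 exprS invfM.
have p0 : 0 < (2 : R) ^- n by rewrite invr_gt0 exprn_gt0.
have p1 : (2 : R) ^- n <= 1 by rewrite invf_le1 ?exprn_gt0// exprn_ege1// ler1n.
case: ifPn => u2; last by rewrite ifF//; apply/negbTE; move: u2; rewrite -!ltNge; nra.
rewrite IH; last by lra.
rewrite mulrCA mulrA (_ : (2 * u <= 2 ^- n) = (u <= 2^-1 * 2 ^- n)) //.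
by apply/idP/idP => ?; lra.
Qed.

(** For 0 < u < t one has u/t >= 2^n u, so f(u/t) <= f(2^n u) for almost every such u; the null sets
    of both affine maps are discarded. *)
Lemma dil_le (t : R) n : 0 < t -> t <= 2 ^- n ->
  (rho (dil t f) <= rho (iter n (@V0 R) f))%E.
Proof.
move=> t0 tn.
have tI0 : 0 < t^-1 by rewrite invr_gt0.
have p0 : 0 < (2 : R) ^+ n by rewrite exprn_gt0.
have p1 : (2 : R) ^- n <= 1 by rewrite invf_le1 ?exprn_gt0// exprn_ege1// ler1n.
have t1 : t <= 1 by exact: le_trans tn p1.
have mint : Num.min 1 t = t by apply/min_idPr.
apply: (sn_ideal S); [|exact: meas01_iter_V0|].
  apply: measurable_fun_if => //.
  - apply: measurable_funTS.
    by apply: measurable_and; exact: measurable_fun_ltr.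
  - rewrite (_ : (fun u => f (u / t)) = fun u => f (aff t^-1 0 u)); last first.
      by apply/funext => u; rewrite /aff addr0 mulrC.
    apply: measurable_comp_aff => // u [] /=; rewrite !in_itv/= /aff addr0 mint.
    move=> _ /andP[u0 ut].
    by rewrite mulr_ge0 ?ltW//= mulrC ltr_pdivrMr// mul1r.
have fa c : 0 < c -> ae01 (fun u => D01 (aff c 0 u) ->
    (f (aff c 0 u))%:E = rearr f (aff c 0 u)).
  by move=> c0; apply: (ae01_aff (d := 0) c0 f_rearr).
apply: (ae01_mono2 (fa _ tI0) (fa _ p0)) => u; rewrite /= in_itv/= => /andP[u0 u1].
rewrite /aff !addr0 => fu1 fu2; rewrite /dil mint.
case: ifP => [/andP[u0' ut]|_]; last by rewrite normr0.
rewrite iter_V0E// (le_trans (ltW ut) tn).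
have pu : 2 ^+ n * u <= t^-1 * u.
  by rewrite ler_wpM2r// -[leLHS]invrK lef_pV2 ?posrE ?invr_gt0.
have ut1 : t^-1 * u <= 1 by rewrite mulrC ler_pdivrMr// mul1r ltW.
have {}fu1 : (f (t^-1 * u))%:E = rearr f (t^-1 * u).
  by apply: fu1; rewrite in_itv/= ut1 mulr_ge0// ltW.
have {}fu2 : (f (2 ^+ n * u))%:E = rearr f (2 ^+ n * u).
  by apply: fu2; rewrite in_itv/= (le_trans pu ut1) mulr_ge0// ltW.
rewrite mulrC !ger0_norm -?lee_fin ?fu1 ?fu2 ?rearr_ge0//.
exact: rearr_nonincreasing.
Qed.

Lemma fund_ge (t : R) n : 2 ^- n <= t -> (rho (iter n (@V0 R) (fun=> 1%R)) <= fund rho t)%E.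
Proof.
move=> nt; apply: (sn_ideal S); [exact: meas01_iter_V0|exact: meas01_indic|].
apply: ae01_oo => u u0 u1; rewrite (iter_V0E n (fun=> 1) (ltW u1)) /indic01.
case: ifP => un; last by rewrite normr0.
by rewrite (ltW u0) (le_trans un nt).
Qed.

End bound.

Theorem theorem3 (R : realType) (rho : (R -> R) -> \bar R) (f : R -> R) (C : R) :
  symmetric_space rho -> separable_space rho ->
  inX rho f -> ae01 (fun t => (f t)%:E = rearr f t) ->
  abs_representing rho f C ->
  forall t : R, 0 < t -> t <= 1 ->
    (rho (dil t f) <=
      (2 * C)%:E * `| \int[@lebesgue_measure R]_(s in `[0%R : R, 1%R]%classic) (f s)%:E |
        * fund rho t)%E.
Proof.
move=> X _ fX fr frep t t0 t1.
have S := symmetric_space_seminorm X.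
have [n [tn nt]] : exists n, 2 ^- n.+1 < t /\ t <= 2 ^- n.
  have ex : exists n, 2 ^- n < t.
    exists (Num.truncn t^-1).+1; rewrite -[ltRHS]invrK ltf_pV2 ?posrE ?invr_gt0 ?exprn_gt0//.
    apply: lt_le_trans (truncnS_gt _) _.
    by rewrite -natrX ler_nat ltnW// ltn_expl.
  (* The least exponent with 2^-m < t is positive because t <= 1; its predecessor is the required
     n. *)
  case: (ex_minnP ex) => -[|n] tn nmin.
    by move: tn; rewrite expr0 invr1 ltNge t1.
  by exists n; split => //; rewrite leNgt; apply/negP => /nmin; rewrite ltnn.
have m1 := meas01_cst (1 : R).
have mf : meas01 f by case: fX.
have C0 := representing_constant_gt0 X fX frep.
have phin := fund_ge X (ltW tn).
rewrite (sn_iter_V0V1 _ S)// in phin.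
have phi0 : (0 < fund rho t)%E.
  by apply: lt_le_trans phin; apply: sn_iter_V1_gt0 => //; rewrite (symmetric_space_one X).
have [fi|/(integral_nonintegrable fX fr) ->] := pselect (integrable01 f); last first.
  (* Strict positivity of C and of the fundamental function is needed here, since 0 times infinity
     is 0. *)
  by rewrite gt0_muley ?lte_fin ?mulr_gt0// gt0_mulye// leey.
apply: le_trans (dil_le X fX fr t0 nt) _.
rewrite (sn_iter_V0V1 _ S)//.
apply: le_trans (iter_V1_bound X fX fr frep n fi) _.
have f0 : ae01 (fun s => 0 <= f s).
  by apply: (ae01_mono fr) => s _ fs; rewrite -lee_fin fs; exact: rearr_ge0.
set I := Rintegral _ _ _.
have I0 : 0 <= I.
  rewrite -[leLHS](Rintegral01_cst (0 : R)); apply: Rintegral01_le => //.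
  exact: integrable01_cst.
have -> : (\int[lebesgue_measure]_(s in `[0%R, 1%R]) (f s)%:E = I%:E)%E.
  by rewrite /I /Rintegral fineK//; exact: integrable_fin_num.
have -> : ((2 * C)%:E * `|I%:E| = (C * I)%:E * 2%:E)%E.
  by rewrite abse_EFin ger0_norm// -!EFinM; congr EFin; ring.
rewrite -muleA.
apply: lee_wpmul2l; first by rewrite lee_fin mulr_ge0// ltW.
(* Doubling for rho_n passes from the interval of length 2^-n to that of length 2^-(n+1), which fits
   into [0, t]. *)
apply: le_trans (sn_one_le_double (seminorm_iter_V1 n S)) _.
by apply: lee_wpmul2l; rewrite -?iterSr.
Qed.
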